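(* Let $\lfloor\cdot\rceil$ be the nearest odd choice function, assigning to $z$ a nearest Gaussian integer $x+yi$ with $x+y$ odd; its fundamental set is $K=\{z:|\operatorname{Re}z|+|\operatorname{Im}z|\le1\}$. Define $$K_1=\{z\in K:|z-\tfrac{-1-i}{2}|\le\tfrac1{\sqrt2},\ |z-\tfrac{-1+i}{2}|\le\tfrac1{\sqrt2}\},$$ $$K_2=\{z\in K:|z-\tfrac{-1-i}{2}|\ge\tfrac1{\sqrt2},\ 0\le\operatorname{Im}z\le-\operatorname{Re}z\},$$ $$K_3=\{z\in K:|z-\tfrac{1+i}{2}|\ge\tfrac1{\sqrt2},\ -\operatorname{Im}z\le\operatorname{Re}z\le0\},$$ $$K_j=-i\,K_{j-3}\quad\text{for }j=4,\dots,12.$$ Then the nearest odd algorithm satisfies the finite building property with $\mathcal{P}=\{K_1,\dots,K_{12}\}$.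
   Context: Here $i=\sqrt{-1}$. For a choice function $\lfloor\cdot\rceil$ (a map to $\mathbb{Z}[i]$ with $|z-\lfloor z\rceil|\le1$) the fundamental set is $K=\overline{\{z-\lfloor z\rceil\}}$, and the Gauss map $G:K\to K$ is $G(z)=-1/z-\lfloor-1/z\rceil$ for $z\neq0$, $G(0)=0$. (The convention used for points equidistant from several odd Gaussian integers affects only a null set.) A finite partition of $K$ is a finite collection of closed sets with boundaries of zero Lebesgue measure and pairwise disjoint interiors whose union is $K$. A set is buildable from a collection $\mathcal{C}$ of closed sets (with null boundaries) if it is equal, up to measure zero, to some union of elements of $\mathcal{C}$. The algorithm satisfies the finite building property with $\mathcal{P}=\{K_1,\dots,K_N\}$ if $N>1$, $\mathcal{P}$ is a finite partition of $K$, and each $G(K_j)$ is buildable from $\mathcal{P}$. *)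

(* Defs.v *)
From HB Require Import structures.
From mathcomp Require Import all_boot all_order all_algebra.
From mathcomp Require Import all_classical all_reals all_analysis.
From mathcomp Require Import complex.

Set Implicit Arguments.
Unset Strict Implicit.
Unset Printing Implicit Defensive.

Import Order.TTheory GRing.Theory Num.Theory.
Import numFieldNormedType.Exports.

Local Open Scope classical_set_scope.
Local Open Scope ring_scope.
Local Open Scope complex_scope.

(* The complex plane is R[i].  Its metric topology is the one that the library
   puts on R[i]^o, which is convertible to R[i]; the norm `|z| and the order
   are R[i]-valued, and `|z| <= r%:C compares real numbers. *)

Section Plane.
Variable R : realType.
Implicit Types (z w : R[i]) (A B : set R[i]).

Definition planar_null A : Prop :=
  ((@lebesgue_measure R) \x (@lebesgue_measure R))%E.-negligible
    [set p : R * R | A (p.1 +i* p.2)].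

Definition boundary A : set R[i] :=
  closure (A : set R[i]^o) `\` interior (A : set R[i]^o).

Definition gaussian_int w : Prop :=
  exists x y : int, w = x%:~R +i* y%:~R.

Definition odd_gaussian_int w : Prop :=
  exists x y : int, w = x%:~R +i* y%:~R /\ ~~ (2 %| x + y)%Z.

Definition choice_function (fl : R[i] -> R[i]) : Prop :=
  forall z, gaussian_int (fl z) /\ `|z - fl z| <= 1.

(* A nearest odd Gaussian integer need not be unique; ties are broken
   arbitrarily. *)
Definition nearest_odd (fl : R[i] -> R[i]) : Prop :=
  forall z, odd_gaussian_int (fl z) /\
    forall w, odd_gaussian_int w -> `|z - fl z| <= `|z - w|.

Definition fundamental_set (fl : R[i] -> R[i]) : set R[i] :=
  closure ([set z - fl z | z in [set: R[i]]] : set R[i]^o).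

Definition gauss_map (fl : R[i] -> R[i]) z : R[i] :=
  if z == 0 then 0 else - 1 / z - fl (- 1 / z).

Definition finite_partition (A : set R[i]) (N : nat) (P : 'I_N -> set R[i]) :
    Prop :=
  [/\ forall j, closed (P j : set R[i]^o),
      forall j, planar_null (boundary (P j)),
      forall i j : 'I_N, i != j ->
        interior (P i : set R[i]^o) `&` interior (P j : set R[i]^o) = set0
    & \bigcup_(j in [set: 'I_N]) P j = A].

Definition buildable (F : set (set R[i])) A : Prop :=
  exists2 U : set (set R[i]), U `<=` F &
    let B := \bigcup_(X in U) X in planar_null ((A `\` B) `|` (B `\` A)).

Definition finite_building_property (fl : R[i] -> R[i]) (N : nat)
    (P : 'I_N -> set R[i]) : Prop :=
  [/\ (1 < N)%N,
      finite_partition (fundamental_set fl) P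
    & forall j, buildable (range P) (gauss_map fl @` P j)].

Definition diamond : set R[i] :=
  [set z | `|complex.Re z| + `|complex.Im z| <= 1].

Definition piece1 : set R[i] :=
  [set z | [/\ diamond z,
    `|z - (- 1 - 'i%C) / 2| <= (1 / Num.sqrt 2)%:C
  & `|z - (- 1 + 'i%C) / 2| <= (1 / Num.sqrt 2)%:C]].

Definition piece2 : set R[i] :=
  [set z | [/\ diamond z,
    `|z - (- 1 - 'i%C) / 2| >= (1 / Num.sqrt 2)%:C
  & 0 <= complex.Im z <= - complex.Re z]].

Definition piece3 : set R[i] :=
  [set z | [/\ diamond z,
    `|z - (1 + 'i%C) / 2| >= (1 / Num.sqrt 2)%:C
  & - complex.Im z <= complex.Re z <= 0]].

(* Indices are shifted by one: [piece k] is K_{k+1}. *)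
Fixpoint piece (k : nat) : set R[i] :=
  match k with
  | 0 => piece1
  | 1 => piece2
  | 2 => piece3
  | k'.+3 => [set - 'i%C * z | z in piece k']
  end.

End Plane.

Arguments diamond R : clear implicits.
Arguments piece R k : clear implicits.

(* Main.v *)
(* In the coordinate u + vi = -1/z the arcs and diagonals bounding the pieces
   become lines: K_1 is the cone u >= 1 + |v|, and K_2 and K_3 are the strips
   0 <= u - v <= 1 and 0 <= v - u <= 1 of the first quadrant, outside a disc.
   The plane is tiled by unit diamonds centred at the odd Gaussian integers; the
   cone contains a whole tile, so G(K_1) is the diamond, and each of the strips
   cuts the tiles it meets along the same diagonal, so G(K_2) and G(K_3) are two
   halves of the diamond, which are unions of pieces.  The remaining pieces
   follow by rotation: multiplication by i preserves odd Gaussian integers and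
   conjugates one nearest odd choice function to another.  All boundaries and
   ties lie on one null set, [curves]. *)
Require Import Defs.
From mathcomp Require Import all_boot all_order all_algebra.
From mathcomp Require Import all_classical all_reals all_analysis.
From mathcomp Require Import measurable_realfun complex zify ring lra.

Set Implicit Arguments.
Unset Strict Implicit.
Unset Printing Implicit Defensive.

Import Order.TTheory GRing.Theory Num.Theory.
Import numFieldNormedType.Exports.

Local Open Scope classical_set_scope.
Local Open Scope ring_scope.
Local Open Scope complex_scope.

(** * The exceptional null set *)

Section NullSet.
Variable R : realType.
Implicit Types (z w : R[i]) (A B : set R[i]).

(* The sides of the diamond, the lines x = y and x = -y, and the arcs bounding
   K_1 and its rotations. *)
Definition curves : set R[i] :=
  [set z | let x := `|complex.Re z| in let y := `|complex.Im z| in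
    [\/ x + y = 1, x = y | x ^+ 2 + y ^+ 2 = `|x - y| ] ].

Lemma finite_quadratic (b c : R) : finite_set [set y | y ^+ 2 + b * y + c = 0].
Proof.
have [[y0 h0]|h] := pselect (exists y, y ^+ 2 + b * y + c = 0); last first.
  by apply: (@sub_finite_set _ _ set0) => // y hy; case: h; exists y.
(* By Vieta, the root other than [y0] is [- b - y0]. *)
apply: (@sub_finite_set _ _ [set y0; - b - y0]) => [y /= hy|].
  have /eqP : (y - y0) * (y - (- b - y0)) = 0.
    by rewrite -(subrr 0) -{1}hy -h0; ring.
  by rewrite mulf_eq0 !subr_eq0 => /orP[]/eqP ->; [left|right].
by rewrite finite_setU; split; exact: finite_set1.
Qed.

(** For fixed [x], squaring the first two equations and splitting the third by the signs of [y] and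
    of |x| - |y| leaves six monic quadratics in [y]. *)
Lemma finite_curves_section (x : R) : finite_set [set y | curves (x +i* y)].
Proof.
have sq (t : R) : `|t| ^+ 2 = t ^+ 2 by rewrite -normrX ger0_norm ?sqr_ge0.
pose q b c := [set y : R | y ^+ 2 + b * y + c = 0].
apply: (@sub_finite_set _ _ (q 0 (- (1 - `|x|) ^+ 2) `|` q 0 (- x ^+ 2) `|`
  (q 1 (x ^+ 2 - `|x|) `|` q (-1) (x ^+ 2 - `|x|)) `|`
  (q 1 (x ^+ 2 + `|x|) `|` q (-1) (x ^+ 2 + `|x|)))); last first.
  by rewrite !finite_setU; do !split; exact: finite_quadratic.
move=> y; rewrite /curves /q /= !sq => -[h|h|].
- left; left; left; rewrite -sq.
  have -> : `|y| = 1 - `|x| by lra.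
  by ring.
- by left; left; right; rewrite -(sq x) h sq; ring.
- have [hxy|hxy] := lerP `|y| `|x| => h; [left; right|right].
    by case: (ger0P y) h => _ h; [left|right]; lra.
  by case: (ger0P y) h => _ h; [right|left]; lra.
Qed.

(** Fubini: the product measure integrates the lengths of the vertical sections, which are finite
    sets. *)
Lemma curves_null : planar_null curves.
Proof.
pose N : set (R * R) := [set p | curves (p.1 +i* p.2)].
have mN : measurable N.
  have mx : measurable_fun [set: R * R] (fun p => `|p.1|).
    exact: measurableT_comp.
  have my : measurable_fun [set: R * R] (fun p => `|p.2|).
    exact: measurableT_comp.
  have meq (f g : R * R -> R) : measurable_fun setT f ->
      measurable_fun setT g -> measurable [set p | f p = g p].
    move=> mf mg.
    rewrite (_ : [set p | f p = g p] = setT `&` (f \- g) @^-1` [set 0]).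
      by apply: measurable_funB => //; exact: measurable_set1.
    by rewrite setTI; apply/seteqP; split=> p /= /eqP; rewrite ?subr_eq0 => h;
      apply/eqP; rewrite ?subr_eq0.
  rewrite (_ : N = [set p | `|p.1| + `|p.2| = 1] `|` [set p | `|p.1| = `|p.2|]
    `|` [set p | `|p.1| ^+ 2 + `|p.2| ^+ 2 = `| `|p.1| - `|p.2| | ]);
    last first.
    by apply/seteqP; split=> p /=; [case; tauto|case=> [[]|] h;
      [apply: Or31|apply: Or32|apply: Or33]].
  apply: measurableU; [apply: measurableU|]; apply: meq => //.
  - exact: measurable_funD.
  - by apply: measurable_funD; apply: measurable_funX.
  - by apply: measurableT_comp => //; apply: measurable_funB.
exists N; split => //.
rewrite /product_measure1 /=.
apply: integral0_eq => x _.
apply: countable_lebesgue_measure0; apply: finite_set_countable.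
by apply: (sub_finite_set _ (finite_curves_section x)) => y /xsectionP.
Qed.

End NullSet.

(** * Topology of the plane in real coordinates *)

Section Topology.
Variable R : realType.
Implicit Types (z w : R[i]) (A B : set R[i]).

Lemma normc_sqr_le z (r : R) : 0 <= r ->
  (`|z| <= r%:C) = (complex.Re z ^+ 2 + complex.Im z ^+ 2 <= r ^+ 2).
Proof.
move=> r0; rewrite normc_def lecR -{1}(ger0_norm r0) -sqrtr_sqr ler_sqrt //.
exact: sqr_ge0.
Qed.

Lemma normc_sqr_ge z (r : R) : 0 <= r ->
  (r%:C <= `|z|) = (r ^+ 2 <= complex.Re z ^+ 2 + complex.Im z ^+ 2).
Proof.
move=> r0; rewrite normc_def lecR -{1}(ger0_norm r0) -sqrtr_sqr ler_sqrt //.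
by rewrite addr_ge0 ?sqr_ge0.
Qed.

Lemma nbhs_square z A : nbhs (z : R[i]^o) A -> exists2 e : R, 0 < e &
  forall a b, `|a - complex.Re z| <= e -> `|b - complex.Im z| <= e ->
    A (a +i* b).
Proof.
move=> /nbhs_ballP [e /= e0 eA].
(* The radius [e] is complex; [0 < e] forces its imaginary part to vanish, so half its real part is
   a smaller real radius. *)
have [r r0 re] : exists2 r : R, 0 < r & r%:C < e.
  move: e0; rewrite ltcE /= => /andP[/eqP ei er].
  by exists (complex.Re e / 2); rewrite ?ltcE /= ?divr_gt0 ?ei ?eqxx //=; lra.
exists (r / 2); first lra.
move=> a b ha hb; apply: eA; apply: le_lt_trans re.
rewrite normc_sqr_le /=; last exact: ltW.
have sq (t : R) : t ^+ 2 = `|t| ^+ 2 by rewrite -normrX ger0_norm ?sqr_ge0.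
case: z ha hb => x y /= ha hb; rewrite (sq (_ - _)) (sq (y - _)).
rewrite (distrC x) (distrC y).
have := normr_ge0 (a - x); have := normr_ge0 (b - y); nra.
Qed.

Lemma continuous_Re : continuous (@complex.Re R : R[i]^o -> R).
Proof.
move=> z; apply/(@cvgrPdist_le _ _ _ _ (nbhs_filter (z : R[i]^o))) => e e0.
have eC : (0 : R[i]) < e%:C by rewrite ltcR.
apply: filterS (nbhsx_ballx (z : R[i]^o) _ eC) => w /=; rewrite /ball /=.
move=> /ltW; rewrite -lecR; apply: le_trans.
by rewrite -raddfB; exact: normc_ge_Re.
Qed.

Lemma continuous_Im : continuous (@complex.Im R : R[i]^o -> R).
Proof.
move=> z; apply/(@cvgrPdist_le _ _ _ _ (nbhs_filter (z : R[i]^o))) => e e0.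
have eC : (0 : R[i]) < e%:C by rewrite ltcR.
apply: filterS (nbhsx_ballx (z : R[i]^o) _ eC) => w /=; rewrite /ball /=.
move=> /ltW; rewrite normc_sqr_le; last exact: ltW.
move=> h; rewrite -(@ler_pXn2r _ 2) ?nnegrE ?(ltW e0) // -normrX.
rewrite ger0_norm ?sqr_ge0 //.
case: z w h => [x y] [a b] /=; have := sqr_ge0 (x - a); lra.
Qed.

Lemma closed_ge0 (f : R[i]^o -> R) :
  continuous f -> closed ([set z | 0 <= f z] : set R[i]^o).
Proof.
move=> cf; rewrite (_ : [set z | _] = f @^-1` [set x | 0 <= x]) //.
exact: preimage_closed.
Qed.

(** An interior point would put a whole vertical segment, of positive length, inside a finite
    section of [curves]. *)
Lemma interior_sub_curves A : A `<=` @curves R ->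
  interior (A : set R[i]^o) = set0.
Proof.
move=> Ac; apply/seteqP; split=> // z /nbhs_square [e e0 eA].
suff : lebesgue_measure `[complex.Im z - e, complex.Im z + e]%classic = 0
    :> \bar R.
  rewrite lebesgue_measure_itv /= lte_fin ifT; last lra.
  by rewrite -EFinD => -[] h; lra.
apply: countable_lebesgue_measure0; apply: finite_set_countable.
apply: (sub_finite_set _ (finite_curves_section (complex.Re z))) => y /=.
rewrite in_itv /= => hy; apply: Ac; apply: eA.
  by rewrite subrr normr0 ltW.
by rewrite ler_distl.
Qed.

End Topology.

(** * The pieces: inequalities, rotation, closedness *)

Section Pieces.
Variable R : realType.
Implicit Types (z w : R[i]) (A B H : set R[i]) (x y : R) (k m n : nat).

Lemma mulIc x y : 'i%C * (x +i* y) = - y +i* x :> R[i].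
Proof. by simpc. Qed.

(** The image under -i is the preimage under i; with [mulIc], membership in a rotated piece becomes
    a substitution in the inequalities of the first three. *)
Lemma pieceS k z : piece R k.+3 z <-> piece R k ('i%C * z).
Proof.
case: z => x y; rewrite mulIc; split=> [[[a b] hw [<- <-]]|h].
  by move: hw; congr (piece R k (_ +i* _)); ring.
by exists (- y +i* x) => //; simpc.
Qed.

(** Twelve index steps are four quarter turns. *)
Lemma piece_period k : piece R (k + 12) = piece R k.
Proof.
have i4 z : 'i%C * ('i%C * ('i%C * ('i%C * z))) = z.
  by case: z => x y; simpc.
by rewrite addnC; apply/seteqP; split=> z; rewrite !pieceS i4.
Qed.

Let centersE : ((- 1 - 'i%C) / 2 = (- 1 / 2) +i* (- 1 / 2) :> R[i]) *
  ((- 1 + 'i%C) / 2 = (- 1 / 2) +i* (1 / 2) :> R[i]) *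
  ((1 + 'i%C) / 2 = (1 / 2) +i* (1 / 2) :> R[i]).
Proof.
have n2 : 2 != 0 :> R[i] by rewrite pnatr_eq0.
by split; [split|]; apply: (mulIf n2); rewrite divfK //; simpc;
  congr (_ +i* _); field.
Qed.

Let sqrt_half : (1 / Num.sqrt 2) ^+ 2 = 1 / 2 :> R.
Proof. by rewrite expr_div_n sqr_sqrtr ?ler0n // expr1n. Qed.

Let sqrt_half_ge0 : 0 <= 1 / Num.sqrt 2 :> R.
Proof. by rewrite divr_ge0 ?sqrtr_ge0. Qed.

(** The bounding circles pass through 0, their centres having modulus equal to the radius, so
    squaring leaves no constant term. *)
Lemma piece0E x y : piece R 0 (x +i* y) <->
  [/\ `|x| + `|y| <= 1, x ^+ 2 + y ^+ 2 + x + y <= 0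
    & x ^+ 2 + y ^+ 2 + x - y <= 0].
Proof.
rewrite /= /piece1 /diamond /= !normc_sqr_le // sqrt_half.
rewrite !centersE; simpc => /=.
by split=> -[? ? ?]; split=> //; lra.
Qed.

Lemma piece1E x y : piece R 1 (x +i* y) <->
  [/\ `|x| + `|y| <= 1, 0 <= x ^+ 2 + y ^+ 2 + x + y, 0 <= y & y <= - x].
Proof.
rewrite /= /piece2 /diamond /= !normc_sqr_ge // sqrt_half.
rewrite !centersE; simpc => /=.
split=> [[? ? /andP[? ?]]|[? ? ? ?]]; split=> //; last by apply/andP.
  by lra.
by lra.
Qed.

Lemma piece2E x y : piece R 2 (x +i* y) <->
  [/\ `|x| + `|y| <= 1, 0 <= x ^+ 2 + y ^+ 2 - x - y, - y <= x & x <= 0].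
Proof.
rewrite /= /piece3 /diamond /= !normc_sqr_ge // sqrt_half.
rewrite !centersE; simpc => /=.
split=> [[? ? /andP[? ?]]|[? ? ? ?]]; split=> //; last by apply/andP.
  by lra.
by lra.
Qed.

Lemma curves_rot z : curves ('i%C * z) <-> curves z.
Proof.
case: z => x y; rewrite mulIc /curves /= normrN addrC [_ ^+ 2 + _]addrC distrC.
by split=> -[->|->|->]; [apply: Or31|apply: Or32|apply: Or33
  |apply: Or31|apply: Or32|apply: Or33].
Qed.

Lemma diamond_rot z : diamond R ('i%C * z) <-> diamond R z.
Proof. by case: z => x y; rewrite mulIc /diamond /= normrN addrC. Qed.

(** Three base pieces, and a step that is a quarter turn. *)
Lemma piece_ind (P : nat -> Prop) :
  P 0%N -> P 1%N -> P 2%N -> (forall k, P k -> P k.+3) -> forall k, P k.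
Proof.
move=> P0 P1 P2 PS k; suff [] : [/\ P k, P k.+1 & P k.+2] by [].
by elim: k => [//|k [? ? ?]]; split=> //; exact: PS.
Qed.

Lemma piece_sub_diamond k : piece R k `<=` diamond R.
Proof.
elim/piece_ind: k => [||| k IH]; try by move=> z [].
by move=> z /pieceS /IH /diamond_rot.
Qed.

Lemma continuous_mulIc : continuous (fun z : R[i]^o => 'i%C * z : R[i]^o).
Proof. by move=> z; exact: (@scaler_continuous _ _ 'i%C). Qed.

Lemma continuous_l1 :
  continuous (fun z : R[i]^o => `|complex.Re z| + `|complex.Im z|).
Proof.
have cA (f : R[i]^o -> R) (z : R[i]^o) : {for z, continuous f} ->
    {for z, continuous (fun z : R[i]^o => `|f z|)}.
  move=> cf; exact: (@continuous_comp _ _ _ f (fun t : R => `|t|) z cf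
    (@norm_continuous R R (f z))).
move=> z; exact: (@continuousD _ R _ _ _ z (cA _ z (@continuous_Re R z))
  (cA _ z (@continuous_Im R z))).
Qed.

Lemma diamond_closed : closed (diamond R : set R[i]^o).
Proof.
have cN : continuous (fun z : R[i]^o => - (`|complex.Re z| + `|complex.Im z|)).
  by move=> z; exact: (@continuousN _ R _ _ z (@continuous_l1 z)).
have c1 : continuous (fun _ : R[i]^o => 1 : R) by exact: cst_continuous.
rewrite (_ : diamond R =
    [set z | 0 <= 1 - (`|complex.Re z| + `|complex.Im z|)]).
  by apply: closed_ge0 => z; exact: (@continuousD _ R _ _ _ z (c1 z) (cN z)).
by apply/seteqP; split=> z; rewrite /diamond /= subr_ge0.
Qed.

(** The base pieces are finite intersections of the diamond with sets where a continuous function is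
    nonnegative; the others are preimages under multiplication by i. *)
Lemma piece_closed k : closed (piece R k : set R[i]^o).
Proof.
have cD (f g : R[i]^o -> R) : continuous f -> continuous g ->
    continuous (fun z : R[i]^o => f z + g z).
  by move=> cf cg z; exact: (@continuousD _ R _ f g z (cf z) (cg z)).
have cN (f : R[i]^o -> R) : continuous f ->
    continuous (fun z : R[i]^o => - f z).
  by move=> cf z; exact: (@continuousN _ R _ f z (cf z)).
have cX (f : R[i]^o -> R) : continuous f ->
    continuous (fun z : R[i]^o => f z ^+ 2).
  move=> cf z; exact: (@continuous_comp _ _ _ f (fun t : R => t ^+ 2) z (cf z)
    (@exprn_continuous R 2 (f z))).
pose re : R[i]^o -> R := @complex.Re R; pose im : R[i]^o -> R := @complex.Im R.
have cre : continuous re := @continuous_Re R.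
have cim : continuous im := @continuous_Im R.
have cdiam := diamond_closed.
have c0 : closed ([set z : R[i]^o | 0 <= im z] : set R[i]^o).
  by apply: closed_ge0.
elim/piece_ind: k => [||| k IH].
- rewrite (_ : piece R 0 = diamond R `&`
    [set z | 0 <= - (re z ^+ 2 + im z ^+ 2 + re z + im z)] `&`
    [set z | 0 <= - (re z ^+ 2 + im z ^+ 2 + re z - im z)]).
    by do 2?apply: closedI => //; apply: closed_ge0; auto 10.
  apply/seteqP; split=> -[x y]; rewrite piece0E /diamond /re /im /=.
    by case=> *; split; [split|]; lra.
  by case=> -[*]; split; lra.
- rewrite (_ : piece R 1 = diamond R `&`
    [set z | 0 <= re z ^+ 2 + im z ^+ 2 + re z + im z] `&`
    ([set z | 0 <= im z] `&` [set z | 0 <= - (re z + im z)])).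
    by do 3?apply: closedI => //; apply: closed_ge0; auto 10.
  apply/seteqP; split=> -[x y]; rewrite piece1E /diamond /re /im /=.
    by case=> *; split; split; lra.
  by case=> -[? ?] [? ?]; split; lra.
- rewrite (_ : piece R 2 = diamond R `&`
    [set z | 0 <= re z ^+ 2 + im z ^+ 2 - re z - im z] `&`
    ([set z | 0 <= re z + im z] `&` [set z | 0 <= - re z])).
    by do 3?apply: closedI => //; apply: closed_ge0; auto 10.
  apply/seteqP; split=> -[x y]; rewrite piece2E /diamond /re /im /=.
    by case=> *; split; split; lra.
  by case=> -[? ?] [? ?]; split; lra.
- rewrite (_ : piece R k.+3 = (fun z => 'i%C * z) @^-1` piece R k).
    exact: (proj1 (continuous_closedP _) continuous_mulIc).
  by apply/seteqP; split=> z /pieceS.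
Qed.

End Pieces.

(** * The twelve pieces partition the diamond *)

Section Partition.
Variable R : realType.
Implicit Types (z w : R[i]) (A B H : set R[i]) (x y : R) (k m n : nat).

Lemma not_curves x y : ~ curves (x +i* y) ->
  [/\ `|x| + `|y| != 1, `|x| != `|y| & x ^+ 2 + y ^+ 2 != `| `|x| - `|y| | ].
Proof.
have sq (t : R) : `|t| ^+ 2 = t ^+ 2 by rewrite -normrX ger0_norm ?sqr_ge0.
by rewrite /curves /= !sq => h; split; apply/eqP => e; apply: h;
  [apply: Or31|apply: Or32|apply: Or33].
Qed.

(** Off [curves] the weak inequalities become strict, which is what makes overlaps contradictory in
    [piece_overlap]. *)
Lemma piece0_off_curves x y : piece R 0 (x +i* y) -> ~ curves (x +i* y) ->
  [/\ x < 0, `|x| + `|y| < 1, x + y < 0, x - y < 0 &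
      (x ^+ 2 + y ^+ 2 + x + y < 0) /\ (x ^+ 2 + y ^+ 2 + x - y < 0)].
Proof.
move=> /piece0E[h1 h2 h3] /not_curves[/eqP n1 /eqP n2 /eqP n3].
have sx := sqr_ge0 x; have sy := sqr_ge0 y.
(* The sum of the two disc inequalities is 2(x^2 + y^2 + x) <= 0. *)
have x0 : x <= 0 by lra.
rewrite (ler0_norm x0) in h1 n1 n2 n3 *.
have hxy : `|y| < - x.
  rewrite lt_neqAle; apply/andP; split; first by apply/eqP; lra.
  by case: (ger0P y) => *; lra.
move: n3; rewrite ger0_norm; last by rewrite subr_ge0 ltW.
by case: (ger0P y) h1 n1 hxy => y0 *; split; try split; try lra.
Qed.

Lemma piece1_off_curves x y : piece R 1 (x +i* y) -> ~ curves (x +i* y) ->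
  [/\ 0 < y, x + y < 0, y - x < 1 & 0 < x ^+ 2 + y ^+ 2 + x + y].
Proof.
move=> /piece1E[h1 h2 h3 h4] /not_curves[/eqP n1 /eqP n2 /eqP n3].
have x0 : x <= 0 by lra.
rewrite (ler0_norm x0) (ger0_norm h3) in h1 n1 n2 n3 *.
rewrite ger0_norm in n3; last by rewrite subr_ge0.
(* On the real axis only 0 and -1 satisfy the inequalities, and both lie on [curves]. *)
have y0 : 0 < y.
  rewrite lt_neqAle h3 andbT; apply/eqP => y0; rewrite -y0 in h1 n1 h2 n2 n3.
  by nra.
by split; lra.
Qed.

Lemma piece2_off_curves x y : piece R 2 (x +i* y) -> ~ curves (x +i* y) ->
  [/\ x < 0, 0 < x + y, y - x < 1 & 0 < x ^+ 2 + y ^+ 2 - x - y].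
Proof.
move=> /piece2E[h1 h2 h3 h4] /not_curves[/eqP n1 /eqP n2 /eqP n3].
have y0 : 0 <= y by lra.
rewrite (ler0_norm h4) (ger0_norm y0) in h1 n1 n2 n3 *.
rewrite ler0_norm in n3; last by lra.
(* Here the excluded points are 0 and i on the imaginary axis. *)
have x0 : x < 0.
  rewrite lt_neqAle h4 andbT; apply/eqP => x0; rewrite x0 in h1 n1 h2 n2 n3.
  by nra.
by split; lra.
Qed.

(** Rotating both pieces together brings the smaller index below 3; then each remaining [n] gives
    inequalities incompatible with the strict ones. *)
Lemma piece_overlap m n z : (m < n < 12)%N ->
  piece R m z -> piece R n z -> curves z.
Proof.
elim/piece_ind: m n z => [||| m IH] n [x y] /andP[mn n12] hm hn;
  have x2 := sqr_ge0 x; have y2 := sqr_ge0 y.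
- apply: contrapT => hc; have [? ? ? ? [? ?]] := piece0_off_curves hm hc.
  by do 12?[case: n mn n12 hn => [|n] mn n12 hn //]; move: hn;
    do ?rewrite pieceS mulIc; rewrite (piece0E, piece1E, piece2E) => -[*]; lra.
- apply: contrapT => hc; have [? ? ? ?] := piece1_off_curves hm hc.
  by do 12?[case: n mn n12 hn => [|n] mn n12 hn //]; move: hn;
    do ?rewrite pieceS mulIc; rewrite (piece0E, piece1E, piece2E) => -[*]; lra.
- apply: contrapT => hc; have [? ? ? ?] := piece2_off_curves hm hc.
  by do 12?[case: n mn n12 hn => [|n] mn n12 hn //]; move: hn;
    do ?rewrite pieceS mulIc; rewrite (piece0E, piece1E, piece2E) => -[*]; lra.
- case: n mn n12 hn => [|[|[|n]]] // mn n12 /pieceS hn; move/pieceS: hm => hm.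
  apply/curves_rot; apply: IH hm hn; apply/andP; split=> //.
  by do 3 apply: ltnW.
Qed.

(** The western quadrant |y| <= -x of the diamond is covered by K_1, K_2 and K_12, and the other
    quadrants rotate into it. Indices are reduced modulo 12 at the end. *)
Lemma piece_cover z : diamond R z -> exists2 k, (k < 12)%N & piece R k z.
Proof.
suff cover : diamond R z -> exists k, piece R k z.
  move=> /cover[k hk]; exists (k %% 12)%N; rewrite ?ltn_pmod //.
  move: hk; rewrite {1}(divn_eq k 12); elim: (k %/ 12)%N => // q IH.
  by rewrite mulSn -addnA addnC piece_period.
have west x y : `|x| + `|y| <= 1 -> `|y| <= - x ->
    exists k, piece R k (x +i* y).
  move=> h1 h2.
  have [y0|y0] := leP 0 y.
    rewrite ger0_norm // in h2.
    have [h|h] := leP (x ^+ 2 + y ^+ 2 + x + y) 0.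
      by exists 0%N; apply/piece0E; split; lra.
    by exists 1%N; apply/piece1E; split; lra.
  rewrite ltr0_norm // in h2.
  have [h|h] := leP (x ^+ 2 + y ^+ 2 + x - y) 0.
    by exists 0%N; apply/piece0E; split; lra.
  (* K_12 = i K_3 is the mirror image of K_2 in the real axis. *)
  exists 11%N; do 3 rewrite pieceS mulIc; apply/piece2E.
  by rewrite !normrN !opprK addrC !sqrrN; split; lra.
case: z => x y; rewrite /diamond /= => h.
have h' : `|y| + `|x| <= 1 by rewrite addrC.
have [hW|hW] := leP `|y| (- x); first exact: west.
have [hN|hN] := leP `|x| y.
  have [k hk] : exists k, piece R k (- y +i* x).
    by apply: west; rewrite ?normrN ?opprK.
  by exists k.+3; apply/pieceS; rewrite mulIc.
have [hE|hE] := leP `|y| x.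
  have [k hk] : exists k, piece R k (- x +i* - y).
    by apply: west; rewrite ?normrN ?opprK.
  by exists k.+3.+3; do 2 rewrite pieceS mulIc.
have [k hk] : exists k, piece R k (y +i* - x).
  apply: west; rewrite ?normrN //.
  by case: (ger0P x) hN => ?; case: (ger0P y) hW hE => *; lra.
by exists k.+3.+3.+3; do 3 rewrite pieceS mulIc; rewrite opprK.
Qed.

(** Off [curves], [z] avoids the other eleven pieces and the sides of the diamond. These are closed
    conditions to avoid, so a neighbourhood avoids them too, and by [piece_cover] it lies in piece
    [k]. *)
Lemma open_piece_off_curves k z : (k < 12)%N -> piece R k z -> ~ curves z ->
  interior (piece R k : set R[i]^o) z.
Proof.
move=> k12 hz hc.
pose others := \bigcup_(j in `I_12 `\ k) piece R j.
have cO : closed (others : set R[i]^o).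
  apply: closed_bigcup => [|j _]; last exact: piece_closed.
  exact/finite_setD/finite_II.
pose outside : set R[i] := [set w | 0 <= `|complex.Re w| + `|complex.Im w| - 1].
have cE : closed (outside : set R[i]^o).
  have c1 : continuous (fun _ : R[i]^o => - 1 : R) by exact: cst_continuous.
  apply: closed_ge0 => w.
  exact: (@continuousD _ R _ _ _ w (@continuous_l1 R w) (c1 w)).
have : nbhs (z : R[i]^o) (~` others `&` ~` outside).
  apply: open_nbhs_nbhs; split.
    by apply: openI; exact: closed_openC.
  split=> [[j /= [j12 jk] hj]|].
    apply: hc; case: (ltngtP j k) jk => [jk|jk|] // _.
      by apply: piece_overlap hj hz; rewrite jk.
    by apply: piece_overlap hz hj; rewrite jk.
  rewrite /outside /= subr_ge0 => h; apply: hc; apply: Or31.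
  by apply/eqP; rewrite eq_le h andbT; exact: piece_sub_diamond hz.
apply: filterS => w [hO]; rewrite /outside /= subr_ge0 => /negP; rewrite -ltNge.
move=> /ltW /piece_cover[j j12 hj]; have [<-//|/eqP jk] := eqVneq j k.
by case: hO; exists j.
Qed.

(** Boundaries lie in [curves]; two interiors meet in the interior of a subset of [curves], which is
    empty. *)
Lemma piece_finite_partition :
  finite_partition (diamond R) (fun j : 'I_12 => piece R j).
Proof.
split=> [j|j|i j ij|]; first exact: piece_closed.
- apply: negligibleS (curves_null R) => p [].
  rewrite -(proj1 (closure_id _) (@piece_closed R j)) => hp hi.
  by apply: contrapT => hc; apply: hi; exact: open_piece_off_curves.
- rewrite -interiorI; apply: interior_sub_curves => z [hi hj].
  case: (ltngtP i j) ij => [ij _|ij _|/val_inj->]; last by rewrite eqxx.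
    by apply: piece_overlap hi hj; rewrite ij /=.
  by apply: piece_overlap hj hi; rewrite ij /=.
- apply/seteqP; split=> [z [j _]|z /piece_cover[k k12 hk]].
    exact: piece_sub_diamond.
  by exists (Ordinal k12).
Qed.

End Partition.

(** * Nearest odd integers and the tiling by unit diamonds *)

Section NearestOdd.
Variable R : realType.
Implicit Types (z w g : R[i]) (A B H : set R[i]) (x y u v a b : R).
Implicit Types (fl : R[i] -> R[i]).

Lemma normc_le z w : (`|z| <= `|w|) =
  (complex.Re z ^+ 2 + complex.Im z ^+ 2 <=
   complex.Re w ^+ 2 + complex.Im w ^+ 2).
Proof. by rewrite !normc_def lecR ler_sqrt // addr_ge0 ?sqr_ge0. Qed.

Lemma mulNiK z : 'i%C * (- 'i%C * z) = z.
Proof. by case: z => x y; simpc. Qed.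

Lemma mulINK z : - 'i%C * ('i%C * z) = z.
Proof. by case: z => x y; simpc. Qed.

Lemma odd_rot w : odd_gaussian_int w -> odd_gaussian_int ('i%C * w).
Proof.
move=> [p [q [-> pq]]]; exists (- q), p; rewrite mulIc rmorphN; split=> //.
by lia.
Qed.

Lemma nearest_odd_rot fl : nearest_odd fl ->
  nearest_odd (fun w => - 'i%C * fl ('i%C * w)).
Proof.
have norm_i z : `|'i%C * z| = `|z|.
  by case: z => x y; rewrite mulIc !normc_def /= sqrrN addrC.
have odd_rotN w : odd_gaussian_int w -> odd_gaussian_int (- 'i%C * w).
  have -> : - 'i%C * w = 'i%C * ('i%C * ('i%C * w)).
    by case: w => x y; simpc.
  by move=> hw; do 3 apply: odd_rot.
move=> hfl z; have [hodd hmin] := hfl ('i%C * z).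
split=> [|w hw]; first exact: odd_rotN.
have -> : `|z - - 'i%C * fl ('i%C * z)| = `|'i%C * z - fl ('i%C * z)|.
  by rewrite -[LHS]norm_i mulrBr mulNiK.
by rewrite -(norm_i (z - w)) mulrBr; apply: hmin; exact: odd_rot.
Qed.

(** Compare [fl z] with its four diagonal neighbours, also odd: expanding the squares for a + bi = z
    - fl z gives sa + tb <= 1 for all signs s, t. *)
Lemma nearest_odd_diamond fl z : nearest_odd fl -> diamond R (z - fl z).
Proof.
move=> /(_ z)[[p [q [-> pq]]] hmin]; case: z hmin => x y hmin.
have near (s t : int) : ~~ (2 %| s + t + p + q)%Z ->
    (x - p%:~R) ^+ 2 + (y - q%:~R) ^+ 2 <=
    (x - p%:~R - s%:~R) ^+ 2 + (y - q%:~R - t%:~R) ^+ 2.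
  move=> st; have := hmin ((p + s)%:~R +i* (q + t)%:~R).
  rewrite normc_le; simpc => /=; rewrite !rmorphD !opprD !addrA; apply.
  by exists (p + s), (q + t); rewrite !rmorphD; split=> //; lia.
have h1 := near 1 1 ltac:(lia); have h2 := near 1 (-1) ltac:(lia).
have h3 := near (-1) 1 ltac:(lia); have h4 := near (-1) (-1) ltac:(lia).
rewrite /diamond; simpc => /=.
by case: (ger0P (x - _)); case: (ger0P (y - _)) => *; lra.
Qed.

(** Two such centres are at l1 distance less than 2, so the sum and the difference of the
    coordinates of [fl z - g] are below 2 in absolute value. Both are even, hence 0. *)
Lemma nearest_odd_unique fl z g : nearest_odd fl -> odd_gaussian_int g ->
  `|complex.Re (z - g)| + `|complex.Im (z - g)| < 1 -> fl z = g.
Proof.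
move=> hfl [p' [q' [-> pq']]]; have := nearest_odd_diamond z hfl.
have [[p [q [-> pq]]] _] := hfl z.
case: z => x y; rewrite /diamond; simpc => /= hd hg.
have lt2 (s : int) : `|s%:~R : R| < 2 -> (- 2 < s < 2)%R.
  by rewrite -(intr_norm R s) (ltr_int R _ 2) ltr_norml.
have hs : (- 2 < (p - p') + (q - q') < 2)%R.
  apply: lt2; rewrite !(rmorphD, rmorphN) /= ltr_norml.
  move: hd hg; case: (ger0P (x - p%:~R)); case: (ger0P (y - q%:~R));
  by case: (ger0P (x - p'%:~R)); case: (ger0P (y - q'%:~R)) => *; lra.
have ht : (- 2 < (p - p') - (q - q') < 2)%R.
  apply: lt2; rewrite !(rmorphD, rmorphN) /= ltr_norml.
  move: hd hg; case: (ger0P (x - p%:~R)); case: (ger0P (y - q%:~R));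
  by case: (ger0P (x - p'%:~R)); case: (ger0P (y - q'%:~R)) => *; lra.
have -> : p = p' by lia.
by have -> : q = q' by lia.
Qed.

Lemma diamond_off_curves a b : diamond R (a +i* b) -> ~ curves (a +i* b) ->
  `|a| + `|b| < 1.
Proof. by rewrite /diamond /= lt_neqAle => -> /not_curves[->]. Qed.

End NearestOdd.

(** * The Gauss map on the first three pieces *)

Section GaussMap.
Variable R : realType.
Implicit Types (z w g : R[i]) (A B H : set R[i]) (x y u v a b : R).
Implicit Types (fl : R[i] -> R[i]).

Lemma gauss_map_diamond fl z : nearest_odd fl -> diamond R (gauss_map fl z).
Proof.
rewrite /gauss_map => hfl; case: ifP => _; last exact: nearest_odd_diamond.
by rewrite /diamond /= normr0 addr0.
Qed.

(** Since -1/(-iz) = i(-1/z), a factor i comes out and leaves the conjugate choice function of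
    [nearest_odd_rot]. *)
Lemma gauss_map_rot fl z :
  gauss_map fl (- 'i%C * z) =
  'i%C * gauss_map (fun w => - 'i%C * fl ('i%C * w)) z.
Proof.
have ii : 'i%C * - 'i%C = 1 :> R[i] by rewrite mulrN -expr2 sqr_i opprK.
have i0 : - 'i%C != 0 :> R[i] by rewrite oppr_eq0 eq_complex /= oner_eq0 andbF.
rewrite /gauss_map mulf_eq0 (negPf i0) /=; case: eqVneq => [_|z0].
  by rewrite mulr0.
rewrite mulrBr mulNiK; suff -> : - 1 / (- 'i%C * z) = 'i%C * (- 1 / z) by [].
apply: (mulIf (mulf_neq0 i0 z0)); rewrite divfK ?mulf_neq0 //.
by rewrite mulrACA divfK // ii mul1r.
Qed.

Lemma neg_inv x y : (x +i* y != 0) ->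
  - 1 / (x +i* y) = (- x / (x ^+ 2 + y ^+ 2)) +i* (y / (x ^+ 2 + y ^+ 2)).
Proof.
move=> z0; have n0 : x ^+ 2 + y ^+ 2 != 0.
  move: z0; apply: contra_neq => /eqP.
  by rewrite paddr_eq0 ?sqr_ge0 // !sqrf_eq0 => /andP[/eqP-> /eqP->].
apply: (mulIf z0); rewrite divfK //; simpc.
by apply/eqP; rewrite eq_complex /=; apply/andP; split; apply/eqP; field.
Qed.

(** The argument is -1/w for w = u + vi, and inversion is an involution. This produces preimages: it
    remains to place w in a suitable tile. *)
Lemma gauss_map_neg_inv fl (p q : int) u v : nearest_odd fl ->
  ~~ (2 %| p + q)%Z -> `|u - p%:~R| + `|v - q%:~R| < 1 ->
  0 < u ^+ 2 + v ^+ 2 ->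
  gauss_map fl ((- u / (u ^+ 2 + v ^+ 2)) +i* (v / (u ^+ 2 + v ^+ 2))) =
  (u - p%:~R) +i* (v - q%:~R).
Proof.
move=> hfl pq uv n0.
have w0 : u +i* v != 0.
  by apply: contraTneq n0 => -[-> ->]; rewrite expr0n addr0 ltxx.
rewrite -neg_inv // /gauss_map mulf_eq0 oppr_eq0 oner_eq0 invr_eq0.
rewrite (negPf w0) /=.
have -> : - 1 / (- 1 / (u +i* v)) = u +i* v.
  by rewrite !mulN1r invrN invrK opprK.
suff -> : fl (u +i* v) = p%:~R +i* q%:~R by simpc.
by apply: nearest_odd_unique => //; exists p, q.
Qed.

Lemma sqr_neg_inv u v (n := u ^+ 2 + v ^+ 2) : 0 < n ->
  (- u / n) ^+ 2 + (v / n) ^+ 2 = n^-1.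
Proof.
by move=> /lt0r_neq0 n0; rewrite !expr_div_n sqrrN -mulrDl expr2 invfM mulrA
  mulfV // mul1r.
Qed.

(** Multiplied by u^2 + v^2, the disc inequalities of [piece0E] become u - v >= 1 and u + v >= 1,
    and the diamond becomes |u| + |v| <= u^2 + v^2. *)
Lemma piece0_neg_inv u v : 1 + `|v| <= u ->
  piece R 0 ((- u / (u ^+ 2 + v ^+ 2)) +i* (v / (u ^+ 2 + v ^+ 2))).
Proof.
move=> h; have v0 := normr_ge0 v.
have n0 : 0 < u ^+ 2 + v ^+ 2 by have := sqr_ge0 v; nra.
have vv : v ^+ 2 = `|v| ^+ 2 by rewrite -normrX ger0_norm ?sqr_ge0.
have e := sqr_neg_inv n0.
set m := (u ^+ 2 + v ^+ 2)^-1 in e *; have m0 : 0 < m by rewrite invr_gt0.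
apply/piece0E; split.
- rewrite !normrM normrN (gtr0_norm m0) (ger0_norm (_ : 0 <= u)); last lra.
  by rewrite -mulrDl ler_pdivrMr // mul1r vv; nra.
- have h1 : 0 <= u - v - 1 by have := ler_norm v; lra.
  by rewrite e; have := mulr_ge0 (ltW m0) h1; lra.
- have h1 : 0 <= u + v - 1 by have := ler_norm (- v); rewrite normrN; lra.
  by rewrite e; have := mulr_ge0 (ltW m0) h1; lra.
Qed.

(** The circle of K_2 becomes the line u = 1 + v, and a side of the diamond becomes the circle u^2 +
    v^2 = u + v. *)
Lemma piece1_neg_inv u v : 0 <= v -> v <= u -> u <= 1 + v ->
  u + v <= u ^+ 2 + v ^+ 2 -> 0 < u ^+ 2 + v ^+ 2 ->
  piece R 1 ((- u / (u ^+ 2 + v ^+ 2)) +i* (v / (u ^+ 2 + v ^+ 2))).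
Proof.
move=> v0 vu uv1 huv n0.
have e := sqr_neg_inv n0.
set m := (u ^+ 2 + v ^+ 2)^-1 in e *; have m0 : 0 < m by rewrite invr_gt0.
apply/piece1E; split.
- rewrite !normrM normrN (gtr0_norm m0) !ger0_norm //; last lra.
  by rewrite -mulrDl ler_pdivrMr // mul1r.
- have h1 : 0 <= 1 + v - u by lra.
  by rewrite e; have := mulr_ge0 (ltW m0) h1; lra.
- by rewrite mulr_ge0 // ltW.
- by rewrite mulNr opprK ler_pM2r.
Qed.

Lemma piece2_neg_inv u v : 0 <= u -> u <= v -> v <= 1 + u ->
  u + v <= u ^+ 2 + v ^+ 2 -> 0 < u ^+ 2 + v ^+ 2 ->
  piece R 2 ((- u / (u ^+ 2 + v ^+ 2)) +i* (v / (u ^+ 2 + v ^+ 2))).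
Proof.
move=> u0 uv vu1 huv n0.
have e := sqr_neg_inv n0.
set m := (u ^+ 2 + v ^+ 2)^-1 in e *; have m0 : 0 < m by rewrite invr_gt0.
apply/piece2E; split.
- rewrite !normrM normrN (gtr0_norm m0) !ger0_norm //; last lra.
  by rewrite -mulrDl ler_pdivrMr // mul1r.
- have h1 : 0 <= 1 + u - v by lra.
  by rewrite e; have := mulr_ge0 (ltW m0) h1; lra.
- by rewrite mulNr lerN2 ler_pM2r.
- by rewrite mulNr oppr_le0 mulr_ge0 // ltW.
Qed.

(* Quantifying over [fl] makes this stable under rotation by i, which changes
   the choice function. *)
Definition gauss_image A H := forall fl, nearest_odd fl ->
  gauss_map fl @` A `<=` H `|` @curves R /\
  H `\` @curves R `<=` gauss_map fl @` A.

Lemma gauss_image_piece0 : gauss_image (piece R 0) (diamond R).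
Proof.
move=> fl hfl; split=> [_ [z _ <-]|[a b] [ab hc]].
  by left; exact: gauss_map_diamond.
have {hc} ab1 := diamond_off_curves ab hc.
(* The tile centred at 3 lies in the cone u >= 1 + |v|; the one centred at 1 does not. *)
have -> : a +i* b = (3 + a - 3%:~R) +i* (b - 0%:~R) by congr (_ +i* _); ring.
have h : 1 + `|b| <= 3 + a by case: (ger0P a) ab1; lra.
rewrite -(gauss_map_neg_inv hfl) //.
- exact/imageP/piece0_neg_inv.
- by rewrite subr0 addrAC subrr add0r.
- by have := sqr_ge0 b; have := normr_ge0 b; nra.
Qed.

Definition half_above : set R[i] :=
  diamond R `&` [set z | complex.Re z <= complex.Im z].

Definition half_below : set R[i] :=
  diamond R `&` [set z | complex.Im z <= complex.Re z].

Lemma gauss_mapE fl x y (n := x ^+ 2 + y ^+ 2) : nearest_odd fl ->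
  x +i* y != 0 -> 0 < n /\ exists p q : int, ~~ (2 %| p + q)%Z /\
    gauss_map fl (x +i* y) = (- x / n - p%:~R) +i* (y / n - q%:~R).
Proof.
move=> hfl z0; split.
  rewrite lt_neqAle addr_ge0 ?sqr_ge0 // andbT eq_sym paddr_eq0 ?sqr_ge0 //.
  by rewrite !sqrf_eq0; move: z0; rewrite eq_complex.
rewrite /gauss_map (negPf z0) neg_inv // -/n.
have [[p [q [-> pq]]] _] := hfl ((- x / n) +i* (y / n)).
by exists p, q; split=> //; simpc.
Qed.

(* On the strip 0 <= Re w - Im w <= 1 the nearest odd integers p + qi have
   p - q = 1, except for ties, where p - q = -1; the strip of the next lemma is
   its mirror image. *)
Lemma gauss_image_piece1 : gauss_image (piece R 1) half_above.
Proof.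
move=> fl hfl; split=> [_ [[x y] hz <-]|[a b] [[ab /= a_le_b] hc]].
  have [->|z0] := eqVneq (x +i* y) 0.
    by left; rewrite /gauss_map eqxx; split; rewrite /diamond /= ?normr0 ?addr0.
  have := gauss_map_diamond (x +i* y) hfl.
  have [n0 [p [q [pq ->]]]] := gauss_mapE hfl z0.
  have nm := divff (lt0r_neq0 n0).
  set m := (x ^+ 2 + y ^+ 2)^-1 in nm *; have m0 : 0 < m by rewrite invr_gt0.
  move/piece1E: hz => [_ h1 h2 h3] hG.
  have h4 : 0 <= - x - y by lra.
  have {h4} hm1 := mulr_ge0 (ltW m0) h4.
  have {h1} hm2 := mulr_ge0 (ltW m0) h1.
  (* For u + vi = -1/z, [hm1] and [hm2] say 0 <= u - v <= 1. The odd number p - q is at least 1,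
     giving Re <= Im, or at most -1, forcing the value onto a side of the diamond. *)
  have : (1 <= p - q)%R \/ (p - q <= -1)%R by lia.
  rewrite -!(ler_int R) !(rmorphB, rmorphN) /= => -[d1|d1].
    by left; split=> //=; lra.
  right; apply: Or31; apply/eqP; rewrite eq_le hG /=.
  have := ler_norm (- x * m - p%:~R); have := ler_norm (- (y * m - q%:~R)).
  by rewrite normrN; lra.
have {hc} ab1 := diamond_off_curves ab hc.
(* The upper half of the tile centred at 2 + i lies in the strip and outside the disc. *)
have -> : a +i* b = (2 + a - 2%:~R) +i* (1 + b - 1%:~R)
  by congr (_ +i* _); ring.
have [/andP[a1 a2] /andP[b1 b2]] : - 1 < a < 1 /\ - (1 / 2) < b < 1.
  by split; apply/andP; case: (ger0P a) ab1; case: (ger0P b) => *; lra.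
have ba1 : b - a < 1 by case: (ger0P a) ab1; case: (ger0P b) => *; lra.
(* Thus u + v >= 2, so u^2 + v^2 >= (u + v)^2 / 2 >= u + v. *)
have ba2 : 0 <= 1 + a + b by case: (ger0P a) ab1; case: (ger0P b) => *; lra.
rewrite -(gauss_map_neg_inv hfl) //.
- by apply: imageP; apply: piece1_neg_inv; nra.
- by rewrite addrAC subrr add0r addrAC subrr add0r.
- by nra.
Qed.

Lemma gauss_image_piece2 : gauss_image (piece R 2) half_below.
Proof.
move=> fl hfl; split=> [_ [[x y] hz <-]|[a b] [[ab /= b_le_a] hc]].
  have [->|z0] := eqVneq (x +i* y) 0.
    by left; rewrite /gauss_map eqxx; split; rewrite /diamond /= ?normr0 ?addr0.
  have := gauss_map_diamond (x +i* y) hfl.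
  have [n0 [p [q [pq ->]]]] := gauss_mapE hfl z0.
  have nm := divff (lt0r_neq0 n0).
  set m := (x ^+ 2 + y ^+ 2)^-1 in nm *; have m0 : 0 < m by rewrite invr_gt0.
  move/piece2E: hz => [_ h1 h2 h3] hG.
  have h4 : 0 <= x + y by lra.
  have {h4} hm1 := mulr_ge0 (ltW m0) h4.
  have {h1} hm2 := mulr_ge0 (ltW m0) h1.
  have : (p - q <= -1)%R \/ (1 <= p - q)%R by lia.
  rewrite -!(ler_int R) !(rmorphB, rmorphN) /= => -[d1|d1].
    by left; split=> //=; lra.
  right; apply: Or31; apply/eqP; rewrite eq_le hG /=.
  have := ler_norm (- (- x * m - p%:~R)); have := ler_norm (y * m - q%:~R).
  by rewrite normrN; lra.
have {hc} ab1 := diamond_off_curves ab hc.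
(* The mirror tile, centred at 1 + 2i. *)
have -> : a +i* b = (1 + a - 1%:~R) +i* (2 + b - 2%:~R)
  by congr (_ +i* _); ring.
have [/andP[a1 a2] /andP[b1 b2]] : - (1 / 2) < a < 1 /\ - 1 < b < 1.
  by split; apply/andP; case: (ger0P a) ab1; case: (ger0P b) => *; lra.
have ba1 : a - b < 1 by case: (ger0P a) ab1; case: (ger0P b) => *; lra.
have ba2 : 0 <= 1 + a + b by case: (ger0P a) ab1; case: (ger0P b) => *; lra.
rewrite -(gauss_map_neg_inv hfl) //.
- by apply: imageP; apply: piece2_neg_inv; nra.
- by rewrite addrAC subrr add0r addrAC subrr add0r.
- by nra.
Qed.

End GaussMap.

(** * Rotating the images and building them from pieces *)

Section Building.
Variable R : realType.
Implicit Types (z w : R[i]) (A B H : set R[i]) (x y : R) (k : nat).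
Implicit Types (fl : R[i] -> R[i]).

(** This is iH: inversion reverses angles, so turning a piece by -i turns its image by i. *)
Definition rotate H : set R[i] := [set z | H (- 'i%C * z)].

Lemma gauss_image_rotate k H :
  gauss_image (piece R k) H -> gauss_image (piece R k.+3) (rotate H).
Proof.
move=> GH fl /nearest_odd_rot/GH[up low].
split=> [_ [_ [w hw <-] <-]|z [hz hc]].
  rewrite gauss_map_rot; have [h|h] := up _ (imageP _ hw).
    by left; rewrite /rotate /= mulINK.
  by right; apply/curves_rot.
have [|w hw e] := low (- 'i%C * z).
  by split=> //; move: hc; rewrite -{1}(mulNiK z) => hc /curves_rot.
by exists (- 'i%C * w); [exists w|rewrite gauss_map_rot e mulNiK].
Qed.

(** Such an [H] is, up to [curves], the union of the pieces inside it. With all indices allowed,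
    rotating [H] only shifts the index by three. *)
Definition cut_by_pieces H := H `<=` diamond R /\
  forall k, piece R k `<=` H \/ piece R k `&` H `<=` @curves R.

Lemma cut_by_pieces_rotate H : cut_by_pieces H -> cut_by_pieces (rotate H).
Proof.
move=> [Hd Hk]; split=> [z /Hd|k]; first by move/diamond_rot; rewrite mulNiK.
have rotN z : piece R k z -> piece R k.+3 (- 'i%C * z).
  by move=> hz; apply/pieceS; rewrite mulNiK.
case: (Hk k.+3) => h; [left=> z /rotN/h //|right=> z [/rotN hz hH]].
by rewrite -(mulNiK z); apply/curves_rot; apply: h.
Qed.

(** Both diagonals are carried through the induction because a quarter turn exchanges them. *)
Lemma piece_diagonal k :
  ((forall z, piece R k z -> complex.Re z <= complex.Im z) \/
   (forall z, piece R k z -> complex.Im z <= complex.Re z)) /\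
  ((forall z, piece R k z -> complex.Re z <= - complex.Im z) \/
   (forall z, piece R k z -> - complex.Im z <= complex.Re z)).
Proof.
elim/piece_ind: k => [|||k IH].
- split; left=> -[x y] /piece0E[_ h1 h2] /=;
    by have := sqr_ge0 x; have := sqr_ge0 y; lra.
- by split; left=> -[x y] /piece1E[_ h1 h2] /=; lra.
- by split; [left|right]=> -[x y] /piece2E[_ h1 h2] /=; lra.
- by split; [case: (proj2 IH)|case: (proj1 IH)] => h; [left|right|right|left];
    move=> -[x y] /pieceS; rewrite mulIc => /h /=; lra.
Qed.

Lemma cut_by_pieces_diamond : cut_by_pieces (diamond R).
Proof. by split=> // k; left; exact: piece_sub_diamond. Qed.

Lemma diagonal_curves z : complex.Re z <= complex.Im z ->
  complex.Im z <= complex.Re z -> curves z.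
Proof.
by move=> h1 h2; apply: Or32; congr `|_|; apply/eqP; rewrite eq_le h1.
Qed.

Lemma cut_by_pieces_above : cut_by_pieces (@half_above R).
Proof.
split=> [z []//|k]; have [[h|h] _] := piece_diagonal k.
  by left=> z hz; split; [exact: piece_sub_diamond hz|exact: h].
by right=> z [/h h1 [_ h2]]; exact: diagonal_curves.
Qed.

Lemma cut_by_pieces_below : cut_by_pieces (@half_below R).
Proof.
split=> [z []//|k]; have [[h|h] _] := piece_diagonal k; last first.
  by left=> z hz; split; [exact: piece_sub_diamond hz|exact: h].
by right=> z [/h h1 [_ h2]]; exact: diagonal_curves.
Qed.

(** The union of all pieces contained in [H] differs from [A] only on [curves]: a point of [H]
    outside that union lies in a piece meeting [H] only along [curves]. *)
Lemma buildable_up_to_curves A H : cut_by_pieces H ->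
  A `<=` H `|` @curves R -> H `\` @curves R `<=` A ->
  buildable (range (fun j : 'I_12 => piece R j)) A.
Proof.
move=> [Hd Hk] AH HA.
exists [set X | range (fun j : 'I_12 => piece R j) X /\ X `<=` H].
  by move=> X [].
apply: negligibleS (curves_null R).
move=> p [[hA hB]|[[X [_ XH] hX] hA]]; last first.
  by apply: contrapT => hc; apply: hA; apply: HA; split=> //; exact: XH.
have [hH|//] := AH _ hA.
have [k k12 hk] := piece_cover (Hd _ hH).
have [kH|kc] := Hk k; last exact: kc.
by case: hB; exists (piece R k) => //; split=> //; exists (Ordinal k12).
Qed.

Lemma piece_image k : exists2 H, cut_by_pieces H & gauss_image (piece R k) H.
Proof.
elim/piece_ind: k => [|||k [H cH GH]].
- exists (diamond R); [exact: cut_by_pieces_diamond|exact: gauss_image_piece0].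
- exists (@half_above R); first exact: cut_by_pieces_above.
  exact: gauss_image_piece1.
- exists (@half_below R); first exact: cut_by_pieces_below.
  exact: gauss_image_piece2.
- exists (rotate H); [exact: cut_by_pieces_rotate|exact: gauss_image_rotate].
Qed.

Lemma nearest_odd_choice fl : nearest_odd fl -> choice_function fl.
Proof.
move=> hfl z; have hd := nearest_odd_diamond z hfl.
have [[p [q [e _]]] _] := hfl z; split; first by exists p, q.
move: hd; rewrite -[1]/(1%:C) normc_sqr_le //; case: (z - fl z) => x y.
rewrite /diamond /=.
by case: (ger0P x); case: (ger0P y) => *; nra.
Qed.

Lemma fundamental_set_nearest_odd fl :
  nearest_odd fl -> fundamental_set fl = diamond R.
Proof.
move=> hfl; apply/seteqP; split.
  rewrite /fundamental_set closureE; apply: smallest_sub.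
    exact: diamond_closed.
  by move=> _ [z _ <-]; exact: nearest_odd_diamond.
move=> [x y] hz A /nbhs_square[e e0 eA]; rewrite /diamond /= in hz eA.
have e1 : 0 < 1 + e by lra.
(* With d < 1 and d <= e, scaling by 1 - d moves each coordinate by at most e and lands strictly
   inside the diamond. *)
pose d := e / (1 + e); have d0 : 0 < d by rewrite divr_gt0.
have d1 : d < 1 by rewrite ltr_pdivrMr //; lra.
have de : d <= e by rewrite ler_pdivrMr //; nra.
have [x0 y0] : 0 <= `|x| /\ 0 <= `|y| by [].
have shrink (t : R) : `|t| <= 1 -> `|(1 - d) * t - t| <= e.
  move=> t1; have -> : (1 - d) * t - t = - (d * t) by ring.
  by rewrite normrN normrM (gtr0_norm d0); have := normr_ge0 t; nra.
exists (((1 - d) * x) +i* ((1 - d) * y)); split; last first.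
  by apply: eA; apply: shrink; lra.
(* The point is shifted to the tile of the odd integer 1, since 0 is even. *)
exists ((1 + (1 - d) * x) +i* ((1 - d) * y)) => //.
rewrite (@nearest_odd_unique _ fl _ 1) //.
- by simpc; congr (_ +i* _); ring.
- by exists 1, 0.
- have d1' : 0 <= 1 - d by lra.
  simpc => /=; rewrite addrAC subrr add0r !normrM (ger0_norm d1') -mulrDr.
  by nra.
Qed.

End Building.

Theorem proposition4p6 (R : realType) (fl : complex R -> complex R)
    (hfl : nearest_odd fl) :
  [/\ choice_function fl,
      fundamental_set fl = diamond R
    & finite_building_property fl (fun j : 'I_12 => piece R j)].
Proof.
split; [exact: nearest_odd_choice|exact: fundamental_set_nearest_odd|].
rewrite /finite_building_property fundamental_set_nearest_odd //.
split=> [//||j]; first exact: piece_finite_partition.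
have [H cH GH] := piece_image R j; have [up low] := GH _ hfl.
exact: buildable_up_to_curves cH up low.
Qed.
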